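(* There exists a continuous $W_4$-equivariant map $f:(S^4)^4_\delta\to S(U_4)$, where $S(U_4)$ is the unit sphere of $U_4$ with respect to the standard inner product.
   Context: $(S^4)^4_\delta=\{(v_1,v_2,v_3,v_4)\in(S^4)^4 : v_i\neq\pm v_j \text{ for } i\neq j\}$, where $S^4\subset\mathbb{R}^5$ is the unit sphere. $W_4=(\mathbb{Z}/2)^4\rtimes S_4$ acts on $(S^4)^4_\delta$: the $i$-th generator of $(\mathbb{Z}/2)^4$ replaces $v_i$ by $-v_i$, and $S_4$ permutes the four factors. Let $V=\mathbb{R}^{\{0,1\}^4}$ be the space of real functions on $\{0,1\}^4$; $W_4$ acts on $V$ by $(\epsilon\cdot g)(\beta)=g(\beta+\epsilon)$ for $\epsilon\in(\mathbb{Z}/2)^4$ (addition mod $2$) and by permuting the coordinates of $\beta$ for $\sigma\in S_4$. $U_4=\{g\in V : \sum_{\beta}g(\beta)=0\}$ is the $15$-dimensional $W_4$-invariant complement of the trivial subrepresentation of constant functions. *)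

(* Defs.v *)
From HB Require Import structures.
From mathcomp Require Import all_boot all_order all_algebra all_fingroup.
From mathcomp Require Import all_classical all_reals all_analysis.

Set Implicit Arguments.
Unset Strict Implicit.
Unset Printing Implicit Defensive.

Import GRing.Theory Num.Theory numFieldNormedType.Exports.
Local Open Scope classical_set_scope.
Local Open Scope ring_scope.

(* (Z/2)^4, which is also the index set {0,1}^4 with addition mod 2. *)
Definition cube := {ffun 'I_4 -> 'Z_2}.

Definition permute_coords (T : Type) (s : 'S_4) (x : 'I_4 -> T) : 'I_4 -> T :=
  fun i => x ((s^-1)%g i).

Definition cube_perm (s : 'S_4) (b : cube) : cube :=
  [ffun i => permute_coords s b i].

(* The semidirect product (Z/2)^4 ><| S_4. MathComp composes permutations from
   left to right, so the composite "first s', then s" is s' * s. *)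
Definition W4 : Type := (cube * 'S_4)%type.

HB.instance Definition _ := Finite.on W4.

Definition W4_one : W4 := (0, 1%g).

Definition W4_mul (w w' : W4) : W4 :=
  (w.1 + cube_perm w.2 w'.1, (w'.2 * w.2)%g).

Definition W4_inv (w : W4) : W4 :=
  (- cube_perm (w.2^-1)%g w.1, (w.2^-1)%g).

Lemma cube_perm1 b : cube_perm 1%g b = b.
Proof. by apply/ffunP => i; rewrite ffunE /permute_coords invg1 perm1. Qed.

Lemma cube_permM s s' b :
  cube_perm (s' * s)%g b = cube_perm s (cube_perm s' b).
Proof.
by apply/ffunP => i; rewrite !ffunE /permute_coords !ffunE /permute_coords
  invMg permM.
Qed.

Lemma cube_permD s b b' :
  cube_perm s (b + b') = cube_perm s b + cube_perm s b'.
Proof. by apply/ffunP => i; rewrite !ffunE /permute_coords !ffunE. Qed.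

Lemma cube_permN s b : cube_perm s (- b) = - cube_perm s b.
Proof. by apply/ffunP => i; rewrite !ffunE /permute_coords !ffunE. Qed.

Lemma W4_mulA : associative W4_mul.
Proof.
move=> x y z; congr pair => /=; last by rewrite mulgA.
by rewrite cube_permD addrA cube_permM.
Qed.

Lemma W4_mul1 : left_id W4_one W4_mul.
Proof. by case=> e s; rewrite /W4_mul /= add0r cube_perm1 mulg1. Qed.

Lemma W4_mulr1 : right_id W4_one W4_mul.
Proof.
case=> e s; rewrite /W4_mul /= mul1g; congr pair.
by apply/ffunP => i; rewrite !ffunE /permute_coords ffunE addr0.
Qed.

Lemma W4_mulV : left_inverse W4_one W4_inv W4_mul.
Proof. by case=> e s; rewrite /W4_mul /= addNr mulgV. Qed.

Lemma W4_mulrV : right_inverse W4_one W4_inv W4_mul.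
Proof.
by case=> e s; rewrite /W4_mul /= cube_permN -cube_permM mulVg cube_perm1 addrN.
Qed.

HB.instance Definition _ :=
  isGroup.Build W4 W4_mulA W4_mul1 W4_mulr1 W4_mulV W4_mulrV.

Section Spaces.
Variable R : realType.

Definition S4 : set 'rV[R]_5 := [set x | \sum_(j < 5) x 0 j ^+ 2 = 1].

(* (R^5)^4 with the product topology *)
Definition quadruple := {ptws 'I_4 -> 'rV[R]_5}.

Definition S4_4_delta : set quadruple :=
  [set v | (forall i, S4 (v i)) /\
           (forall i j, i != j -> v i <> v j /\ v i <> - v j)].

Definition act_config (w : W4) (v : quadruple) : quadruple :=
  fun i => (-1) ^+ (w.1 i : nat) *: permute_coords w.2 v i.

(* V = R^({0,1}^4) with the product topology *)
Definition V := {ptws cube -> R}.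

(* (e . g)(b) = g(b + e) and (s . g)(b) = g(s^-1 . b), the latter being the left
   action of S_4 induced by permuting coordinates; (e, s) acts as e . (s . _). *)
Definition act_V (w : W4) (g : V) : V :=
  fun b => g (cube_perm (w.2^-1)%g (b + w.1)).

Definition U4 : set V := [set g | \sum_(b : cube) g b = 0].

Definition sphere_U4 : set V :=
  [set g | U4 g /\ \sum_(b : cube) g b ^+ 2 = 1].

Lemma act_config1 v : act_config 1%g v = v.
Proof.
apply/funext => i.
by rewrite /act_config /permute_coords ffunE expr0 scale1r invg1 perm1.
Qed.

Lemma act_configM w w' v :
  act_config (w * w')%g v = act_config w (act_config w' v).
Proof.
apply/funext => i; rewrite /act_config /permute_coords /= scalerA invMg permM.
congr (_ *: _); rewrite !ffunE /permute_coords.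
move: (w.1 i) (w'.1 _) => [[|[|//]] ?] [[|[|//]] ?] /=;
  by rewrite /= ?expr0 ?expr1 ?mul1r ?mulr1 ?mulrNN ?mulr1.
Qed.

Lemma act_config_delta w v : S4_4_delta v -> S4_4_delta (act_config w v).
Proof.
move=> [vS vD]; split=> [i|i j neq_ij].
  rewrite /S4 /= -(vS ((w.2^-1)%g i)); apply: eq_bigr => k _.
  by rewrite mxE exprMn sqrr_sign mul1r.
have /vD [D1 D2] : (w.2^-1)%g i != (w.2^-1)%g j by rewrite (inj_eq perm_inj).
rewrite /act_config /permute_coords.
move: (w.1 i) (w.1 j) => [[|[|//]] ?] [[|[|//]] ?] /=;
  rewrite ?expr0 ?expr1 ?scale1r ?scaleN1r ?opprK.
- by [].
- by split=> // /D2.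
- split=> [/(congr1 -%R)|/oppr_inj]; last exact: D1.
  by rewrite opprK => /D2.
- split=> [/oppr_inj|/(congr1 -%R)]; first exact: D1.
  by rewrite opprK => /D2.
Qed.

Lemma act_V1 g : act_V 1%g g = g.
Proof. by apply/funext => b; rewrite /act_V /= invg1 cube_perm1 addr0. Qed.

Lemma act_VM w w' g : act_V (w * w')%g g = act_V w (act_V w' g).
Proof.
apply/funext => b; rewrite /act_V /= invMg cube_permM; congr (g (cube_perm _ _)).
by rewrite addrA !cube_permD -cube_permM mulgV cube_perm1.
Qed.

Lemma act_V_sum (F : R -> R) w g :
  \sum_(b : cube) F (act_V w g b) = \sum_(b : cube) F (g b).
Proof.
rewrite [RHS](reindex (fun b : cube => cube_perm (w.2^-1)%g (b + w.1))) //=.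
exists (fun b : cube => cube_perm w.2 b - w.1) => b _.
  by rewrite -cube_permM mulVg cube_perm1 addrK.
by rewrite subrK -cube_permM mulgV cube_perm1.
Qed.

Lemma act_V_sphere w g : sphere_U4 g -> sphere_U4 (act_V w g).
Proof.
move=> [g0 g1]; split; first by rewrite /U4 /= (act_V_sum id).
by rewrite (act_V_sum (fun x => x ^+ 2)).
Qed.

End Spaces.

(* Main.v *)
(* The action of W_4 on configurations of four lines with chosen unit vectors is
   free.  Cut the space into strata on which an equivariant label in W_4 (an
   orientation of the lines and an ordering of them) is locally constant: each line
   is normalized by its first nonzero coordinate, oriented by the sign of that
   coordinate, and the lines are ordered lexicographically.  Grouping the pieces by
   dimension leaves 14 strata, since the dimension lies between 3 and 16; the
   dimension is a sum of numbers of distinct prefixes, each of which can only drop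
   in a limit, so a limit of the same dimension has the same combinatorial type.
   Distances to the sheets of the k-th stratum give weights, at most one of them
   nonzero for each k, and f is the projection to U_4 of the sum of
   weight(k, w) * w.u_k, normalized.  It does not vanish when the u_k are generic:
   up to 15 vectors w_k.u_k are then linearly independent modulo constants. *)

Require Import Defs.
From mathcomp Require Import all_boot all_order all_algebra all_fingroup.
From mathcomp Require Import all_classical all_reals all_analysis.
From mathcomp Require Import ring lra.

Set Implicit Arguments.
Unset Strict Implicit.
Unset Printing Implicit Defensive.

Import Order.TTheory GRing.Theory Num.Theory numFieldNormedType.Exports.
Local Open Scope classical_set_scope.
Local Open Scope ring_scope.

(** * Counting the distinct values of a function on a finite set *)

Section CountValues.
Variables (I : finType) (T : eqType).
Implicit Types (A B : {set I}) (f g : I -> T).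

Definition nvalues f A := size (undup [seq f i | i in A]).

Lemma nvalues_leq_card f A : (nvalues f A <= #|A|)%N.
Proof. by rewrite (leq_trans (size_undup _)) // size_map -cardE. Qed.

Lemma nvalues_inj f A : {in A &, injective f} -> nvalues f A = #|A|.
Proof.
move=> fI; rewrite /nvalues undup_id ?size_map -?cardE // map_inj_in_uniq ?enum_uniq //.
by move=> i j; rewrite !mem_enum; apply: fI.
Qed.

Lemma nvalues_perm f A (s : {perm I}) :
  nvalues (f \o s) (s @^-1: A) = nvalues f A.
Proof.
apply/perm_size/perm_undup => y; apply/fintype.imageP/fintype.imageP => -[i iA ->].
  by exists (s i) => //; rewrite inE in iA.
by exists ((s^-1)%g i); rewrite ?inE /= permKV.
Qed.

Lemma eq_nvalues f g A : f =1 g -> nvalues f A = nvalues g A.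
Proof. by move=> fg; rewrite /nvalues (eq_image (frefl _) fg). Qed.

Section Refinement.
Variables (f g : I -> T) (A : {set I}).
Hypothesis gf : {in A &, forall i j, g i = g j -> f i = f j}.

(** Translates values of [g] into values of [f]: well defined by [gf] on the values taken on [A],
    the identity elsewhere. *)
Let h (y : T) : T := if [pick i in A | g i == y] is Some i then f i else y.

Let hg i : i \in A -> h (g i) = f i.
Proof.
rewrite /h => iA; case: pickP => [j /andP[jA /eqP]|/(_ i)]; first exact: gf.
by rewrite iA eqxx.
Qed.

Let values_sub :
  {subset undup [seq f i | i in A] <= map h (undup [seq g i | i in A])}.
Proof.
move=> y; rewrite mem_undup => /fintype.imageP[i iA ->].
apply/mapP; exists (g i); last by rewrite hg.
by rewrite mem_undup; apply/fintype.imageP; exists i.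
Qed.

Lemma nvalues_refine : (nvalues f A <= nvalues g A)%N.
Proof.
rewrite /nvalues -(size_map h (undup [seq g i | i in A])).
exact: uniq_leq_size (undup_uniq _) values_sub.
Qed.

(** The map [h] covers the values of [f] by those of [g]; when there are no more of the latter, it
    must be injective. *)
Lemma nvalues_refine_eq :
  (nvalues g A <= nvalues f A)%N -> {in A &, forall i j, f i = f j -> g i = g j}.
Proof.
move=> le_gf i j iA jA fij.
have uh : uniq (map h (undup [seq g i | i in A])).
  by apply: leq_size_uniq (undup_uniq _) values_sub _; rewrite size_map.
have gin k : k \in A -> g k \in undup [seq g i | i in A].
  by move=> kA; rewrite mem_undup; apply/fintype.imageP; exists k.
have [gi gj] := (gin i iA, gin j jA).
rewrite -(nth_index (g i) gi) -(nth_index (g i) gj); congr nth; apply/eqP.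
rewrite -(nth_uniq (h (g i)) _ _ uh) ?size_map ?index_mem //.
by rewrite !(nth_map (g i)) ?index_mem // !nth_index // !hg // fij.
Qed.

End Refinement.

Lemma nvalues_subset f A B : A \subset B -> (nvalues f A <= nvalues f B)%N.
Proof.
move=> /fintype.subsetP AB; apply: uniq_leq_size (undup_uniq _) _ => y.
rewrite !mem_undup => /fintype.imageP[i iA ->]; apply/fintype.imageP.
by exists i => //; apply: AB.
Qed.

Lemma nvalues_new f A B i : A \subset B -> i \in B ->
  {in A, forall j, f i != f j} -> (nvalues f A < nvalues f B)%N.
Proof.
move=> /fintype.subsetP AB iB new.
have : uniq (f i :: undup [seq f i | i in A]).
  rewrite cons_uniq undup_uniq mem_undup andbT; apply/fintype.imageP => -[j jA /eqP].
  by rewrite (negPf (new j jA)).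
move/uniq_leq_size; apply=> y; rewrite in_cons !mem_undup => /orP[/eqP->|].
  by apply/fintype.imageP; exists i.
by move=> /fintype.imageP[j jA ->]; apply/fintype.imageP; exists j => //; apply: AB.
Qed.

End CountValues.

(** * Lines in coordinates: leading entries, normalization, lexicographic order *)

Section Lines.
Variables (R : realFieldType) (d : nat).
Implicit Types (x y : 'rV[R]_d) (p q : 'I_d) (m : nat).

Definition zero_upto m x := [forall p : 'I_d, (p < m)%N ==> (x 0 p == 0)].

Lemma zero_uptoP m x :
  reflect (forall p : 'I_d, (p < m)%N -> x 0 p = 0) (zero_upto m x).
Proof. by apply: (iffP 'forall_implyP) => H p /H => [/eqP|->]. Qed.

Lemma zero_uptoPn m x :
  reflect (exists2 p : 'I_d, (p < m)%N & x 0 p != 0) (~~ zero_upto m x).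
Proof.
rewrite negb_forall; apply: (iffP existsP) => [[p]|[p pm xp]].
  by rewrite negb_imply => /andP[]; exists p.
by exists p; rewrite negb_imply pm.
Qed.

Lemma zero_upto0 x : zero_upto 0 x.
Proof. exact/zero_uptoP. Qed.

Lemma zero_upto_full x : zero_upto d x = (x == 0).
Proof.
apply/zero_uptoP/eqP => [x0|-> p _]; last by rewrite mxE.
by apply/rowP => p; rewrite x0 ?mxE.
Qed.

Lemma zero_upto_le m m' x : (m <= m')%N -> zero_upto m' x -> zero_upto m x.
Proof.
by move=> mm' /zero_uptoP x0; apply/zero_uptoP => p /leq_trans/(_ mm')/x0.
Qed.

Lemma zero_uptoZ c m x : c != 0 -> zero_upto m (c *: x) = zero_upto m x.
Proof. by move=> c0; apply: eq_forallb => p; rewrite mxE mulf_eq0 (negPf c0). Qed.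

Definition leading p x := (x 0 p != 0) && zero_upto p x.

Lemma leading_ex x : x != 0 -> exists p, leading p x.
Proof.
move=> x0; have /existsP[p0 xp0] : [exists p, x 0 p != 0].
  apply: contraR x0; rewrite negb_exists => /forallP x0; apply/eqP/rowP => p.
  by rewrite mxE; apply/eqP; rewrite -[_ == _]negbK.
case: (@arg_minnP _ p0 (fun p => x 0 p != 0) (fun p : 'I_d => p : nat) xp0) => p xp pmin.
exists p; rewrite /leading xp; apply/zero_uptoP => q; apply: contraTeq => /pmin.
by rewrite leqNgt.
Qed.

Lemma leading_le p q x : leading p x -> x 0 q != 0 -> (p <= q)%N.
Proof. by case/andP=> _ /zero_uptoP x0; rewrite leqNgt; apply: contra => /x0->. Qed.

Lemma leading_inj p q x : leading p x -> leading q x -> p = q.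
Proof.
move=> lp lq; apply/val_inj/anti_leq.
by rewrite (leading_le lp) ?(leading_le lq) ?(andP lp).1 ?(andP lq).1.
Qed.

Lemma leading_lt m p x : ~~ zero_upto m x -> leading p x -> (p < m)%N.
Proof. by move=> /zero_uptoPn[q qm xq] /leading_le/(_ xq)/leq_ltn_trans; apply. Qed.

Lemma leadingZ c p x : c != 0 -> leading p (c *: x) = leading p x.
Proof. by move=> c0; rewrite /leading zero_uptoZ // mxE mulf_eq0 (negPf c0). Qed.

Definition lead_coord x : R := if [pick p | leading p x] is Some p then x 0 p else 0.

Lemma lead_coordE p x : leading p x -> lead_coord x = x 0 p.
Proof.
rewrite /lead_coord => lp; case: pickP => [q /leading_inj/(_ lp)->//|].
by move=> /(_ p); rewrite lp.
Qed.

Lemma lead_coord_neq0 x : x != 0 -> lead_coord x != 0.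
Proof. by move=> /leading_ex[p lp]; rewrite (lead_coordE lp); case/andP: lp. Qed.

Lemma lead_coordZ c x : c != 0 -> x != 0 -> lead_coord (c *: x) = c * lead_coord x.
Proof.
move=> c0 /leading_ex[p lp].
by rewrite (lead_coordE lp) (@lead_coordE p) ?leadingZ // mxE.
Qed.

(** Canonical representative of the line through a nonzero [x]: its leading entry becomes 1. *)
Definition normalize x := (lead_coord x)^-1 *: x.

Lemma normalizeE p q x : leading p x -> normalize x 0 q = x 0 q / x 0 p.
Proof. by move=> lp; rewrite /normalize (lead_coordE lp) mxE mulrC. Qed.

Lemma normalizeZ c x : c != 0 -> x != 0 -> normalize (c *: x) = normalize x.
Proof.
move=> c0 x0; rewrite /normalize lead_coordZ // scalerA invfM mulrAC mulVf //.
by rewrite mul1r.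
Qed.

Lemma zero_upto_normalize m x : x != 0 -> zero_upto m (normalize x) = zero_upto m x.
Proof. by move=> x0; rewrite zero_uptoZ // invr_eq0 lead_coord_neq0. Qed.

Definition trunc m x : 'rV[R]_d := \row_p (if (p < m)%N then x 0 p else 0).

Lemma truncP m x y :
  trunc m x = trunc m y <-> forall p : 'I_d, (p < m)%N -> x 0 p = y 0 p.
Proof.
split=> [/rowP e p pm|e]; first by have := e p; rewrite !mxE pm.
by apply/rowP => p; rewrite !mxE; case: ifP => // /e.
Qed.

Lemma trunc_full x : trunc d x = x.
Proof. by apply/rowP => p; rewrite mxE ltn_ord. Qed.

Lemma zero_upto_trunc m x y :
  trunc m x = trunc m y -> zero_upto m x = zero_upto m y.
Proof.
by move=> /truncP e; apply/zero_uptoP/zero_uptoP => z p pm; rewrite -?e ?z ?e // z.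
Qed.

Definition minor p q x y := x 0 p * y 0 q - x 0 q * y 0 p.

(** Nonzero prefixes normalize alike exactly when they are proportional. In terms of minors this is
    a closed condition, which makes it accessible to limits. *)
Lemma trunc_normalizeP m x y : ~~ zero_upto m x -> ~~ zero_upto m y ->
  (trunc m (normalize x) = trunc m (normalize y) <->
   forall p q : 'I_d, (p < m)%N -> (q < m)%N -> minor p q x y = 0).
Proof.
have nz0 z : ~~ zero_upto m z -> z != 0.
  by case/zero_uptoPn=> p _; apply: contraNneq => ->; rewrite mxE.
move=> xm ym; have [[a la] [b lb]] := (leading_ex (nz0 _ xm), leading_ex (nz0 _ ym)).
have [[xa _] [yb _]] := (andP la, andP lb); split=> [/truncP e p q pm qm|e].
  have xE r : x 0 r = x 0 a * normalize x 0 r by rewrite (normalizeE _ la) mulrC divfK.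
  have yE r : y 0 r = y 0 b * normalize y 0 r by rewrite (normalizeE _ lb) mulrC divfK.
  by rewrite /minor (xE p) (xE q) (yE p) (yE q) !e //; ring.
have [am bm] := (leading_lt xm la, leading_lt ym lb).
have exy (p q : 'I_d) : (p < m)%N -> (q < m)%N -> x 0 p * y 0 q = x 0 q * y 0 p.
  by move=> pm qm; apply/eqP; rewrite -subr_eq0; apply/eqP; apply: e.
have ab : a = b.
  have : x 0 a * y 0 b != 0 by rewrite mulf_neq0.
  rewrite exy // mulf_eq0 negb_or => /andP[xb ya].
  by apply/val_inj/anti_leq; rewrite (leading_le la) ?(leading_le lb).
apply/truncP => p pm; rewrite (normalizeE _ la) (normalizeE _ lb) -ab in yb *.
by apply/eqP; rewrite eqr_div // exy // mulrC.
Qed.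

Definition lex_lt x y :=
  [exists p : 'I_d, (x 0 p < y 0 p) && [forall q : 'I_d, (q < p)%N ==> (x 0 q == y 0 q)]].

Lemma lex_ltP x y :
  reflect (exists2 p : 'I_d, x 0 p < y 0 p & trunc p x = trunc p y) (lex_lt x y).
Proof.
apply: (iffP existsP) => [[p /andP[xy /'forall_implyP e]]|[p xy /truncP e]].
  by exists p => //; apply/truncP => q /e/eqP.
by exists p; rewrite xy; apply/'forall_implyP => q /e->.
Qed.

Lemma lex_lt_irr x : lex_lt x x = false.
Proof. by apply/lex_ltP => -[p]; rewrite ltxx. Qed.

Lemma lex_lt_trans : transitive lex_lt.
Proof.
move=> y x z /lex_ltP[p xy /truncP exy] /lex_ltP[q yz /truncP eyz]; apply/lex_ltP.
have [pq|qp|/val_inj pq] := ltngtP p q.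
- exists p; first by rewrite -eyz.
  by apply/truncP => r rp; rewrite exy ?eyz // (ltn_trans rp).
- exists q; first by rewrite exy.
  by apply/truncP => r rq; rewrite exy ?eyz // (ltn_trans rq).
- rewrite -{}pq in yz eyz; exists p; first exact: lt_trans yz.
  by apply/truncP => r rp; rewrite exy ?eyz.
Qed.

Lemma lex_lt_total x y : x != y -> lex_lt x y || lex_lt y x.
Proof.
rewrite -subr_eq0 => /leading_ex[p /andP[]]; rewrite !mxE subr_eq0.
rewrite neq_lt => xy /zero_uptoP e.
have {}e (q : 'I_d) : (q < p)%N -> x 0 q = y 0 q.
  by move=> /e; rewrite !mxE => /eqP; rewrite subr_eq0 => /eqP.
by case/orP: xy => xy; apply/orP; [left|right]; apply/lex_ltP; exists p => //;
  apply/truncP => q /e.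
Qed.

End Lines.

(** * Strata of configurations of lines *)

Section Strata.
Variables (R : realFieldType) (d : nat) (I : finType).
Implicit Types (x y : I -> 'rV[R]_d) (p q : 'I_d) (m : nat) (i j : I).

Definition nz_upto m x : {set I} := [set i | ~~ zero_upto m (x i)].

Definition prefix_class m x i := trunc m (normalize (x i)).

(** The class includes coordinate [m], while the vector must be nonzero before it: pairs of an old
    nonzero prefix and a new entry are counted, one parameter for each. *)
Definition level_dim m x := nvalues (prefix_class m.+1 x) (nz_upto m x).

(* The dimension of the stratum of x: each next coordinate is a free parameter for
   every distinct prefix that is already nonzero, and is normalized to 0 or 1 for
   the zero prefix. *)
Definition stratum_dim x := (\sum_(m < d) level_dim m x)%N.

Definition rank x i := #|[set j | lex_lt (normalize (x j)) (normalize (x i))]%SET|.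

Definition generic x :=
  (forall i, x i != 0) /\ (forall i j, i != j -> normalize (x i) != normalize (x j)).

Lemma rank_lt x i : (rank x i < #|I|)%N.
Proof.
rewrite -[#|I|]cardsT; apply/proper_card/properP; split.
  by apply/fintype.subsetP => j _; rewrite inE.
by exists i; rewrite ?inE // lex_lt_irr.
Qed.

(** Distinct normalized vectors are totally ordered, and the set below the smaller one is strictly
    contained in the set below the larger one. *)
Lemma rank_inj x : generic x -> injective (rank x).
Proof.
move=> [_ xN]; suff lt_rank i j :
    lex_lt (normalize (x i)) (normalize (x j)) -> (rank x i < rank x j)%N.
  move=> i j eij; apply: contraTeq isT => /xN/lex_lt_total/orP[]/lt_rank;
  by rewrite eij ltnn.
move=> ltij; apply/proper_card/properP; split; last by exists i; rewrite inE ?lex_lt_irr.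
by apply/fintype.subsetP => k; rewrite !inE => /lex_lt_trans; apply.
Qed.

Lemma nz_upto0 x : nz_upto 0 x = finset.set0.
Proof. by apply/setP => i; rewrite !inE zero_upto0. Qed.

(* Signs of coordinates and minors can only degenerate in the limit: for fixed x
   the relation holds for all y close to x. *)
Definition specializes x y :=
  (forall i p, x i 0 p != 0 -> Num.sg (y i 0 p) = Num.sg (x i 0 p)) /\
  (forall i j p q, minor p q (x i) (x j) != 0 ->
     Num.sg (minor p q (y i) (y j)) = Num.sg (minor p q (x i) (x j))).

(** * Rigidity of signs and order under specialization *)

Section Rigidity.
Variables x y : I -> 'rV[R]_d.
Hypotheses (xG : generic x) (yG : generic y) (xy : specializes x y).

Let y_neq0 i p : x i 0 p != 0 -> y i 0 p != 0.
Proof. by move=> xp; rewrite -sgr_eq0 (xy.1 _ _ xp) sgr_eq0. Qed.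

Let nz_sub m : nz_upto m x \subset nz_upto m y.
Proof.
apply/fintype.subsetP => i; rewrite !inE => /zero_uptoPn[p pm xp].
by apply/zero_uptoPn; exists p => //; apply: y_neq0.
Qed.

(** A nonzero minor of [x] stays nonzero for [y], so classes that are distinct for [x] cannot merge
    for [y]. *)
Let class_eq m i j : i \in nz_upto m x -> j \in nz_upto m x ->
  prefix_class m y i = prefix_class m y j -> prefix_class m x i = prefix_class m x j.
Proof.
move=> ix jx; have := fintype.subsetP (nz_sub m) _ ix.
have := fintype.subsetP (nz_sub m) _ jx; rewrite !inE in ix jx * => jy iy.
move/(trunc_normalizeP iy jy) => e; apply/(trunc_normalizeP ix jx) => p q pm qm.
apply: contraTeq isT => xpq; have := xy.2 _ _ _ _ xpq.
by rewrite e // sgr0 => /esym/eqP; rewrite sgr_eq0 (negPf xpq).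
Qed.

Let nzS m x' : nz_upto m x' \subset nz_upto m.+1 x'.
Proof.
by apply/fintype.subsetP => i; rewrite !inE; apply: contra; apply: zero_upto_le.
Qed.

Let class_eqS m : {in nz_upto m x &, forall i j,
  prefix_class m.+1 y i = prefix_class m.+1 y j ->
  prefix_class m.+1 x i = prefix_class m.+1 x j}.
Proof.
by move=> i j ix jx; apply: class_eq; apply: fintype.subsetP (nzS _ _) _ _.
Qed.

Let level_dim_le m : (level_dim m x <= level_dim m y)%N.
Proof.
exact: leq_trans (nvalues_refine (@class_eqS m)) (nvalues_subset _ (nz_sub m)).
Qed.

Hypothesis dim_le : (stratum_dim y <= stratum_dim x)%N.

(** Termwise inequalities whose sums compare the other way are all equalities. *)
Let level_dim_eq m : (m < d)%N -> level_dim m x = level_dim m y.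
Proof.
move=> md; apply/eqP; have := eqn_leq (stratum_dim x) (stratum_dim y).
rewrite dim_le leq_sum // /stratum_dim => /eqP e.
by have := (@leqif_sum _ predT _ _ _ (fun (k : 'I_d) _ => leqif_eq (level_dim_le k))).2;
  rewrite e eqxx => /esym/forall_inP/(_ (Ordinal md) isT).
Qed.

(* A vector vanishing up to m for x but not for y, while its (m+1)st coordinate is
   nonzero for x, represents the class [0:...:0:1], which x does not count at
   level m; it stays different from the counted classes, so y counts one more. *)
Let nz_eqS m : (m < d)%N -> nz_upto m.+1 x = nz_upto m.+1 y -> nz_upto m x = nz_upto m y.
Proof.
move=> md eS; apply/eqP; rewrite finset.eqEsubset nz_sub /=.
apply/fintype.subsetP => i iy; apply: contraTT isT => ix.
have ixS : i \in nz_upto m.+1 x by rewrite eS (fintype.subsetP (nzS m y)).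
have : (level_dim m x < level_dim m y)%N.
  apply: leq_ltn_trans (nvalues_refine (@class_eqS m)) _.
  apply: (nvalues_new (nz_sub m) iy) => j jx; apply: contraNneq ix => /class_eq.
  rewrite (fintype.subsetP (nzS m x) _ jx) => /(_ ixS isT) e; move: jx; rewrite !inE.
  apply: contra; rewrite -!(zero_upto_normalize _ (xG.1 _)).
  move=> /zero_uptoP zi; apply/zero_uptoP => p pm.
  by move/truncP: e => <-; rewrite ?zi // ltnW.
by rewrite level_dim_eq // ltnn.
Qed.

(** Descending induction from [m = d], where both sets are everything. Writing [m] as [d - k], the
    truncated subtraction stays at 0 once [k] reaches [d]. *)
Let nz_eq m : (m <= d)%N -> nz_upto m x = nz_upto m y.
Proof.
move=> md; rewrite -(subKn md); elim: (d - m)%N => [|k IHk].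
  rewrite subn0; apply/setP => i.
  by rewrite !inE !zero_upto_full (negPf (xG.1 i)) (negPf (yG.1 i)).
have [kd|dk] := ltnP k d; last first.
  by move: IHk; have /eqP dk0 : (d - k == 0)%N; rewrite ?subn_eq0 // subnS dk0.
by apply: nz_eqS; rewrite -subSn // ?subSS ?leq_subr // subSn.
Qed.

Let zero_upto_eq m i : (m <= d)%N -> zero_upto m (x i) = zero_upto m (y i).
Proof. by move=> /nz_eq/setP/(_ i); rewrite !inE => /negb_inj. Qed.

Let leading_eq p i : leading p (x i) -> leading p (y i).
Proof. by case/andP=> xp zp; rewrite /leading y_neq0 // -zero_upto_eq // ltnW. Qed.

Lemma rigid_lead_sign i : Num.sg (lead_coord (y i)) = Num.sg (lead_coord (x i)).
Proof.
have [p lp] := leading_ex (xG.1 i).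
by rewrite (lead_coordE lp) (lead_coordE (leading_eq lp)) xy.1 //; case/andP: lp.
Qed.

(** For vectors that are nonzero before the last coordinate of the prefix, equal counts turn the
    refinement [class_eqS] into an equality of partitions. *)
Let class_eq_conv m i j : (m <= d)%N -> i \in nz_upto m x ->
  prefix_class m x i = prefix_class m x j -> prefix_class m y i = prefix_class m y j.
Proof.
case: m => [|m] md ix; first by move: ix; rewrite nz_upto0 inE.
move=> exij; have jx : j \in nz_upto m.+1 x.
  move: ix; rewrite !inE -!(zero_upto_normalize _ (xG.1 _)).
  by rewrite (zero_upto_trunc exij).
have [ixm|] := boolP (i \in nz_upto m x).
  have jxm : j \in nz_upto m x.
    move: ixm; rewrite !inE -!(zero_upto_normalize _ (xG.1 _)).
    suff /zero_upto_trunc-> : trunc m (normalize (x i)) = trunc m (normalize (x j)) by [].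
    by move/truncP: exij => e; apply/truncP => p pm; apply/e/ltnW.
  apply: (nvalues_refine_eq (@class_eqS m)) exij => //.
  by have := level_dim_eq md; rewrite /level_dim -(nz_eq (ltnW md)) => ->.
(* Otherwise both vectors lead at coordinate [m], for [x] and for [y], and every normalized prefix
   is [0, ..., 0, 1]. *)
rewrite inE negbK => zi.
have zj : zero_upto m (x j).
  move: zi; rewrite -!(zero_upto_normalize _ (xG.1 _)).
  suff /zero_upto_trunc-> : trunc m (normalize (x i)) = trunc m (normalize (x j)) by [].
  by move/truncP: exij => e; apply/truncP => p pm; apply/e/ltnW.
have lead_m k : k \in nz_upto m.+1 x -> zero_upto m (x k) -> leading (Ordinal md) (y k).
  rewrite inE => /zero_uptoPn[p]; rewrite ltnS leq_eqVlt => /orP[/eqP pm|pm] xp zk.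
    apply: leading_eq; rewrite /leading zk andbT.
    by have <- : p = Ordinal md by apply: val_inj.
  by move: xp; rewrite (zero_uptoP _ _ zk) // eqxx.
have [li lj] := (lead_m _ ix zi, lead_m _ jx zj).
apply/truncP => p; rewrite ltnS leq_eqVlt (normalizeE _ li) (normalizeE _ lj).
case/orP=> [/eqP pm|pm].
  have -> : p = Ordinal md by apply: val_inj.
  by rewrite !divff //; [case/andP: lj|case/andP: li].
by have [/andP[_ /zero_uptoP->//] /andP[_ /zero_uptoP->//]] := (li, lj); rewrite !mul0r.
Qed.

Let lex_lt_conv i j :
  lex_lt (normalize (x i)) (normalize (x j)) -> lex_lt (normalize (y i)) (normalize (y j)).
Proof.
case/lex_ltP=> p ltp e; apply/lex_ltP; exists p; last first.
  have [zi|zi] := boolP (i \in nz_upto p x); first by apply: class_eq_conv => //; apply: ltnW.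
  move: zi; rewrite inE negbK => zi.
  have zj : zero_upto p (x j).
    by move: zi; rewrite -!(zero_upto_normalize _ (xG.1 _)) (zero_upto_trunc e).
  move: zi zj; rewrite !(zero_upto_eq _ (ltnW (ltn_ord p))) -!(zero_upto_normalize _ (yG.1 _)).
  by move=> /zero_uptoP zi /zero_uptoP zj; apply/truncP => q qp; rewrite zi ?zj.
have zij : zero_upto p (x i) = zero_upto p (x j).
  by rewrite -!(zero_upto_normalize _ (xG.1 _)) (zero_upto_trunc e).
(* After a zero prefix the normalized entry at [p] is 0 or 1, and it is the same for [y]. *)
have [zi|nzi] := boolP (zero_upto p (x i)).
  have zj : zero_upto p (x j) by rewrite -zij.
  have normal1 k : zero_upto p (x k) -> x k 0 p != 0 ->
      normalize (x k) 0 p = 1 /\ normalize (y k) 0 p = 1.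
    move=> zk xp; have lk : leading p (x k) by rewrite /leading xp.
    by rewrite (normalizeE _ lk) (normalizeE _ (leading_eq lk)) !divff ?y_neq0.
  have normal0 k : zero_upto p (x k) -> x k 0 p = 0 ->
      normalize (x k) 0 p = 0 /\ normalize (y k) 0 p = 0.
    move=> zk xp; have : zero_upto p.+1 (x k).
      apply/zero_uptoP => q; rewrite ltnS leq_eqVlt => /orP[/eqP/val_inj->//|].
      exact/zero_uptoP.
    move=> zk'; have := zk'; rewrite zero_upto_eq // -(zero_upto_normalize _ (yG.1 _)).
    move: zk'; rewrite -(zero_upto_normalize _ (xG.1 _)).
    by move=> /zero_uptoP->// /zero_uptoP->.
  have [/(normal0 _ zi)[xi0 yi0]|/(normal1 _ zi)[xi1 yi1]] := eqVneq (x i 0 p) 0;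
  have [/(normal0 _ zj)[xj0 yj0]|/(normal1 _ zj)[xj1 yj1]] := eqVneq (x j 0 p) 0.
  - by rewrite xi0 xj0 ltxx in ltp.
  - by rewrite yi0 yj1 ltr01.
  - by rewrite xi1 xj0 ltr10 in ltp.
  - by rewrite xi1 xj1 ltxx in ltp.
have [a la] := leading_ex (xG.1 i); have [b lb] := leading_ex (xG.1 j).
have ap := leading_lt nzi la; rewrite zij in nzi; have bp := leading_lt nzi lb.
have ab : a = b.
  have [[xa _] [xb _]] := (andP la, andP lb); move/truncP: e => e.
  have xja : x j 0 a != 0.
    have := e _ ap; rewrite (normalizeE _ la) (normalizeE _ lb) divff // => /esym/eqP.
    by apply: contraTneq => ->; rewrite mul0r eq_sym oner_eq0.
  have xib : x i 0 b != 0.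
    have := e _ bp; rewrite (normalizeE _ la) (normalizeE _ lb) divff // => /eqP.
    by apply: contraTneq => ->; rewrite mul0r eq_sym oner_eq0.
  by apply/val_inj/anti_leq; rewrite (leading_le la) ?(leading_le lb).
rewrite -{b bp}ab in lb; have [[xia _] [xja _]] := (andP la, andP lb).
(* A difference of normalized entries is a minor divided by the two leading entries, so its sign is
   a product of signs that [specializes] preserves. *)
have diffE (z : I -> 'rV[R]_d) : z i 0 a != 0 -> z j 0 a != 0 ->
    Num.sg (z j 0 p / z j 0 a - z i 0 p / z i 0 a) =
    Num.sg (minor a p (z i) (z j)) * Num.sg (z i 0 a) * Num.sg (z j 0 a).
  move=> zi zj; rewrite -!sgrM; have -> : z j 0 p / z j 0 a - z i 0 p / z i 0 a =
      minor a p (z i) (z j) * z i 0 a * z j 0 a * ((z i 0 a)^-1 * (z j 0 a)^-1) ^+ 2.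
    by rewrite /minor; field; rewrite zi zj.
  by rewrite [LHS]sgrM [X in _ * X = _]gtr0_sg ?mulr1 // exprn_even_gt0 // mulf_neq0 ?invr_eq0.
move: ltp; rewrite !(normalizeE _ la) !(normalizeE _ lb).
rewrite (normalizeE _ (leading_eq la)) (normalizeE _ (leading_eq lb)).
rewrite -subr_gt0 -sgr_gt0 diffE // -[in X in _ -> X]subr_gt0 -[in X in _ -> X]sgr_gt0.
rewrite (diffE y) ?y_neq0 // !(xy.1 _ a) // // => sgm.
by rewrite xy.2 //; apply: contraTneq sgm => ->; rewrite sgr0 !mul0r ltxx.
Qed.

(** The order is strict and total, so its preservation in one direction gives the converse. *)
Lemma rigid_rank i : rank y i = rank x i.
Proof.
congr #|pred_of_set _|; apply/setP => j; rewrite !inE.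
apply/idP/idP => [ltji|]; last exact: lex_lt_conv.
have ij : j != i by apply: contraTneq ltji => ->; rewrite lex_lt_irr.
have /orP[//|/lex_lt_conv ltij] := lex_lt_total (xG.2 _ _ ij).
by have := lex_lt_trans ltij ltji; rewrite lex_lt_irr.
Qed.

End Rigidity.
End Strata.

(** * Linear algebra: vectors in general position *)

Lemma nonroot_ex (R : numDomainType) (q : {poly R}) : q != 0 -> exists t, q.[t] != 0.
Proof.
move=> q0; pose s := [seq i%:R : R | i <- iota 0 (size q)].
have us : uniq s by rewrite map_inj_uniq ?iota_uniq // => i j /eqP; rewrite eqr_nat => /eqP.
have : ~~ all (root q) s.
  by apply/negP => /(max_poly_roots q0)/(_ us); rewrite size_map size_iota ltnn.
by case/allPn=> t _ qt; exists t.
Qed.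

(** A matrix with [#|T|] rows and only [n] columns has a nonzero left kernel. *)
Lemma annihilator_ex (R : fieldType) (T : finType) (n : nat) (F : 'I_n -> T -> R) :
  (n < #|T|)%N ->
  exists2 a : T -> R, (exists b, a b != 0) & forall k, \sum_b a b * F k b = 0.
Proof.
move=> nT; pose M := \matrix_(j < #|T|, k < n) F k (enum_val j).
have : kermx M != 0.
  by rewrite kermx_eq0 -row_leq_rank -ltnNge (leq_ltn_trans (rank_leq_col M)).
case/rowV0Pn=> c /sub_kermxP cM c0; exists (fun b => c 0 (enum_rank b)).
  have /existsP[j cj] : [exists j, c 0 j != 0].
    apply: contraR c0; rewrite negb_exists => /forallP c0; apply/eqP/rowP => j.
    by rewrite mxE; apply/eqP; rewrite -[_ == _]negbK.
  by exists (enum_val j); rewrite enum_valK.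
move=> k; have /rowP/(_ k) := cM; rewrite !mxE => e; rewrite -[RHS]e.
rewrite [RHS](reindex (@enum_rank T)) /=; last exact/onW_bij/enum_rank_bij.
by apply: eq_bigr => b _; rewrite mxE enum_rankK.
Qed.

(* The new vector is taken on the moment curve: a nonzero functional is a nonzero
   polynomial along it, so all but finitely many points avoid the finitely many
   hyperplanes to be avoided. *)
Lemma generic_vectors (R : numFieldType) (T G : finType) (act : G -> T -> T) (n : nat) :
  (forall w, injective (act w)) -> (n < #|T|)%N ->
  exists u : nat -> T -> R, forall (w : nat -> G) (t : nat -> R) (c : R),
    (forall b, \sum_(k < n) t k * u k (act (w k) b) = c) ->
    forall k, (k < n)%N -> t k = 0.
Proof.
move=> actI; elim: n => [|n IHn] nT; first by exists (fun _ _ => 0).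
have [u uP] := IHn (ltnW nT).
(* The extra column of ones makes the annihilator kill constants too, hence the right-hand side
   [c]. *)
pose F (w : {ffun 'I_n -> G}) (k : 'I_n.+1) b : R :=
  if unlift ord_max k is Some j then u j (act (w j) b) else 1.
have af w := cid2 (annihilator_ex (F w) nT).
pose a w := s2val (af w).
have a0 w : exists b, a w b != 0 := s2valP (af w).
have aF w k : \sum_b a w b * F w k b = 0 := s2valP' (af w) k.
(* Its value at [z] is the functional [a wg.1] on the translate by [wg.2] of the curve point
   [z ^+ enum_rank b]. *)
pose q (wg : {ffun 'I_n -> G} * G) : {poly R} :=
  \sum_b a wg.1 b *: 'X^(enum_rank (act wg.2 b)).
have q0 wg : q wg != 0.
  have [b ab] := a0 wg.1; apply: contraNneq ab.
  move=> /(congr1 (fun p : {poly R} => p`_(enum_rank (act wg.2 b)))).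
  rewrite coef0 coef_sum (bigD1 b) //= big1 => [|b' b'b].
    by rewrite coefZ coefXn eqxx mulr1 addr0 => ->.
  rewrite coefZ coefXn (inj_eq val_inj) (inj_eq enum_rank_inj) (inj_eq (@actI _)).
  by rewrite eq_sym (negPf b'b) mulr0.
have /nonroot_ex[z] : \prod_wg q wg != 0 by apply/prodf_neq0.
rewrite horner_prod => /prodf_neq0 qz.
pose v (b : T) : R := z ^+ enum_rank b.
exists (fun k => if k == n then v else u k) => w t c e.
pose wf := [ffun k : 'I_n => w k].
have {}e b : \sum_(k < n) t k * u k (act (w k) b) + t n * v (act (w n) b) = c.
  rewrite -(e b) big_ord_recr /= eqxx; congr (_ + _); apply: eq_bigr => k _.
  by rewrite ltn_eqF.
(* The functional [a wf] kills [c] and the first [n] vectors, leaving [t n] times a nonzero value of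
   [q]. *)
have tn : t n = 0.
  have : \sum_b a wf b * (\sum_(k < n) t k * u k (act (w k) b) + t n * v (act (w n) b)) = 0.
    under eq_bigr do rewrite e.
    have sa : \sum_b a wf b = 0.
      rewrite -[RHS](aF wf ord_max); apply: eq_bigr => b _.
      by rewrite /F unlift_none mulr1.
    by rewrite -mulr_suml sa mul0r.
  under eq_bigr do rewrite mulrDr mulr_sumr.
  rewrite big_split exchange_big /= big1 => [|k _]; last first.
    have := aF wf (lift ord_max k); rewrite /F liftK ffunE => /(congr1 ( *%R (t k))).
    by rewrite mulr0 mulr_sumr => e0; rewrite -[RHS]e0; apply: eq_bigr => b _; rewrite mulrCA.
  rewrite add0r; under eq_bigr do rewrite mulrCA.
  rewrite -mulr_sumr => /eqP; rewrite mulf_eq0 => /orP[/eqP//|/eqP qwz].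
  have := qz (wf, w n) isT; rewrite horner_sum.
  under eq_bigr do rewrite hornerZ hornerXn.
  by rewrite qwz eqxx.
move=> k; rewrite ltnS leq_eqVlt => /orP[/eqP->//|]; apply: (uP w t c) => b.
by rewrite -(e b) tn mul0r addr0.
Qed.

(** * Labels of configurations by elements of [W4] *)

Section Labels.
Variable R : realType.
Implicit Types (v : quadruple R) (w g : W4) (i j : 'I_4).

(** Two unit vectors on one line differ by a scalar with [c ^+ 2 = 1], so they are equal or
    opposite. *)
Lemma generic_delta v : S4_4_delta v -> generic v.
Proof.
move=> [vS vD]; have v0 i : v i != 0.
  apply: contra_eq_neq (vS i) => ->; rewrite big1 => [|j _]; last by rewrite mxE expr0n.
  by rewrite eq_sym oner_eq0.
split=> // i j /vD[neq neqN]; apply/eqP => eN.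
have [ci cj] := (lead_coord_neq0 (v0 i), lead_coord_neq0 (v0 j)).
pose c := lead_coord (v i) / lead_coord (v j).
have vE : v i = c *: v j.
  by rewrite -scalerA -/(normalize (v j)) -eN scalerA mulfV // scale1r.
have : c ^+ 2 = 1.
  rewrite -[RHS](vS i) vE; under eq_bigr do rewrite mxE exprMn.
  by rewrite -mulr_sumr vS mulr1.
move/eqP; rewrite sqrf_eq1 => /orP[]/eqP c1; move: vE; rewrite c1.
  by rewrite scale1r.
by rewrite scaleN1r.
Qed.

(** Level 0 counts nothing and the other four levels at most 4 each. Level 4 counts whole lines,
    omitting only the last coordinate axis, so at least 3. *)
Lemma stratum_dim_bounds v : S4_4_delta v -> (3 <= stratum_dim v <= 16)%N.
Proof.
move=> vX; have [v0 vN] := generic_delta vX.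
rewrite /stratum_dim big_ord_recl big_ord_recr /= /level_dim nz_upto0.
have -> : nvalues (prefix_class 1 v) finset.set0 = 0%N.
  by apply/eqP; rewrite -leqn0 (leq_trans (nvalues_leq_card _ _)) // cards0.
rewrite add0n; apply/andP; split.
  rewrite (leq_trans _ (leq_addl _ _)) // nvalues_inj; last first.
    move=> i j _ _; rewrite /prefix_class !trunc_full; apply: contra_eq; exact: vN.
  suff le1 : (#|~: nz_upto 4 v| <= 1)%N.
    by rewrite -(leq_add2r #|~: nz_upto 4 v|) cardsC card_ord -[4%N]/(3 + 1)%N leq_add2l.
  apply/card_le1_eqP => i j; rewrite !inE !negbK => zi zj.
  apply: contraTeq isT => /vN/eqP[].
  have l4 k : zero_upto 4 (v k) -> leading ord_max (v k).
    move=> zk; rewrite /leading zk andbT; have [p lp] := leading_ex (v0 k).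
    have [/andP[vp _]] := lp; have [p4|] := ltnP p 4.
      by rewrite (zero_uptoP _ _ zk) ?eqxx in vp.
    move=> p4; rewrite (_ : ord_max = p) //; apply: val_inj => /=.
    by apply/eqP; rewrite eqn_leq p4 -ltnS ltn_ord.
  apply/rowP => p; rewrite (normalizeE _ (l4 _ zi)) (normalizeE _ (l4 _ zj)).
  have [p4|p4] := ltnP p 4.
    by rewrite (zero_uptoP _ _ zi p p4) (zero_uptoP _ _ zj p p4) !mul0r.
  have -> : p = ord_max.
    by apply: val_inj => /=; apply/eqP; rewrite eqn_leq p4 andbT -ltnS ltn_ord.
  by have [/andP[vi _] /andP[vj _]] := (l4 _ zi, l4 _ zj); rewrite !divff.
rewrite !big_ord_recr big_ord0 /= add0n.
have le4 m : (nvalues (prefix_class m.+1 v) (nz_upto m v) <= 4)%N.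
  by rewrite (leq_trans (nvalues_leq_card _ _)) // -[X in (_ <= X)%N](card_ord 4) max_card.
by rewrite -[16%N]/(4 + 4 + 4 + 4)%N !leq_add.
Qed.

Lemma stratum_dim_act g v : S4_4_delta v ->
  stratum_dim (act_config g v) = stratum_dim v.
Proof.
move=> /generic_delta[v0 _]; apply: eq_bigr => m _.
rewrite /level_dim -[RHS](nvalues_perm _ _ (g.2^-1)%g).
rewrite (_ : nz_upto m (act_config g v) = ((g.2^-1)%g : 'S_4) @^-1: nz_upto m v).
  by apply: eq_nvalues => i; rewrite /prefix_class /= /act_config normalizeZ ?signr_eq0 ?v0.
by apply/setP => i; rewrite !inE /act_config zero_uptoZ ?signr_eq0.
Qed.

(** The element [w] that carries a positively oriented, sorted configuration to one with the signs
    and order of [v]; the inverse matches [act_config]. *)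
Definition label v w :=
  (forall i, Num.sg (lead_coord (v i)) = (-1) ^+ (w.1 i : nat)) /\
  (forall i, rank v i = (w.2^-1)%g i :> nat).

Lemma label_ex v : S4_4_delta v -> exists w, label v w.
Proof.
move=> /generic_delta vG.
have rI : injective (fun i => Ordinal (leq_trans (rank_lt v i) (eq_leq (card_ord 4)))).
  by move=> i j /(congr1 val) /(rank_inj vG).
exists ([ffun i => if 0 < lead_coord (v i) then 0 else 1], (perm rI)^-1%g); split=> i /=.
  rewrite ffunE; case: ltrgt0P (lead_coord_neq0 (vG.1 i)) => // c _.
    by rewrite gtr0_sg.
  by rewrite ltr0_sg.
by rewrite invgK permE.
Qed.

Lemma sign_Z2_inj (a b : 'Z_2) : (-1) ^+ (a : nat) = (-1) ^+ (b : nat) :> R -> a = b.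
Proof.
case: a b => [[|[|//]] ia] [[|[|//]] ib] /= /eqP; rewrite ?expr0 ?expr1.
- by move=> _; apply: val_inj.
- by rewrite eq_sym eqNr oner_eq0.
- by rewrite eqNr oner_eq0.
- by move=> _; apply: val_inj.
Qed.

Lemma label_uniq v w w' : label v w -> label v w' -> w = w'.
Proof.
move: w w' => [e s] [e' s'] [/= sg1 r1] [/= sg2 r2]; congr pair.
  by apply/ffunP => i; apply: sign_Z2_inj; rewrite -sg1 -sg2.
by apply: invg_inj; apply/permP => i; apply: ord_inj; rewrite -r1 -r2.
Qed.

Lemma rank_act g v i : S4_4_delta v ->
  rank (act_config g v) i = rank v ((g.2^-1)%g i).
Proof.
move=> /generic_delta[v0 _]; rewrite /rank -[RHS](card_imset _ (@perm_inj _ g.2)).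
congr #|pred_of_set _|; apply/setP => j.
rewrite !inE /act_config /permute_coords !normalizeZ ?signr_eq0 //.
by rewrite -{2}(permKV g.2 j) mem_imset ?inE //; apply: perm_inj.
Qed.

Lemma label_act g v w : S4_4_delta v -> label v w -> label (act_config g v) (g * w)%g.
Proof.
move=> vX [sgv rv]; have [v0 _] := generic_delta vX.
split=> i /=; last by rewrite rank_act // rv invMg permM.
rewrite /act_config /permute_coords lead_coordZ ?signr_eq0 // sgrM sgv !ffunE /permute_coords.
move: (g.1 i) (w.1 _) => [[|[|//]] ?] [[|[|//]] ?] /=;
  by rewrite /= ?expr0 ?expr1 ?sgrN ?sgr1 ?mul1r ?mulr1 ?mulrNN ?mulr1.
Qed.

Lemma label_rigid v v' w : S4_4_delta v -> S4_4_delta v' ->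
  specializes v v' ->
  stratum_dim v' = stratum_dim v ->
  label v w -> label v' w.
Proof.
move=> /generic_delta vG /generic_delta v'G vv' dE [sgv rv]; split=> i.
  by rewrite (rigid_lead_sign vG v'G vv') ?dE.
by rewrite (rigid_rank vG v'G vv') ?dE.
Qed.

End Labels.

(** * Limits of signs, of sums and in function spaces *)

Lemma cvg_sgr (R : realType) (T : Type) (F : set_system T) {FF : Filter F}
    (f : T -> R) (l : R) :
  f @ F --> l -> l != 0 -> \forall t \near F, Num.sg (f t) = Num.sg l.
Proof.
move=> fl; rewrite neq_lt => /orP[l0|l0].
  by apply: filterS (cvgr_lt _ fl _ l0) => t ft; rewrite !ltr0_sg.
by apply: filterS (cvgr_gt _ fl _ l0) => t ft; rewrite !gtr0_sg.
Qed.

Lemma cvg_sumr (R : realType) (T : Type) (F : set_system T) {FF : Filter F}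
    (I : finType) (f : I -> T -> R) (l : I -> R) :
  (forall i, f i @ F --> l i) -> (\sum_i f i t) @[t --> F] --> \sum_i l i.
Proof. by move=> fl; apply: cvg_big => // x; apply: add_continuous. Qed.

Lemma cvg_ptws (X : topologicalType) (R : realType) (T : Type) (F : set_system X)
    {FF : Filter F} (f : X -> {ptws T -> R}) (l : {ptws T -> R}) :
  (forall b, f x b @[x --> F] --> l b) -> f @ F --> l.
Proof.
move=> fl; apply/cvg_sup => b U [?/= [[W oW <-]]] /= Wl /filterS; apply.
by apply: (fl b); apply: open_nbhs_nbhs.
Qed.

(** * An invariant distance on configurations *)

Section Distance.
Variable R : realType.
Implicit Types (v : quadruple R) (A B : set (quadruple R)).

(** The l1 distance on 20 coordinates, for which [W4] acts by isometries. *)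
Definition qdist v v' := \sum_i \sum_j `|v i 0 j - v' i 0 j|.

Lemma qdist_ge0 v v' : 0 <= qdist v v'.
Proof. by do 2![apply: sumr_ge0 => ? _]. Qed.

Lemma qdistxx v : qdist v v = 0.
Proof. by apply: big1 => i _; apply: big1 => j _; rewrite subrr normr0. Qed.

Lemma qdist_triangle v v' v'' : qdist v v'' <= qdist v v' + qdist v' v''.
Proof.
rewrite -big_split; apply: ler_sum => i _; rewrite -big_split; apply: ler_sum => j _.
exact: ler_distD.
Qed.

Lemma qdistC v v' : qdist v v' = qdist v' v.
Proof. by do 2![apply: eq_bigr => ? _]; rewrite distrC. Qed.

Lemma coord_le_qdist v v' i j : `|v i 0 j - v' i 0 j| <= qdist v v'.
Proof.
rewrite /qdist (bigD1 i) //= (bigD1 j) //= -addrA lerDl addr_ge0 ?sumr_ge0 // => k _.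
by apply: sumr_ge0.
Qed.

Lemma qdist_act (w : W4) v v' : qdist (act_config w v) (act_config w v') = qdist v v'.
Proof.
rewrite /qdist [RHS](reindex_inj (@perm_inj _ (w.2^-1)%g)); apply: eq_bigr => i _.
apply: eq_bigr => j _; rewrite /act_config /permute_coords !mxE -mulrBr normrM.
by rewrite normr_sign mul1r.
Qed.

Lemma coordinate_continuous i j : continuous (fun v : quadruple R => v i 0 j).
Proof.
move=> v; apply: (@continuous_comp _ _ _ (fun v : quadruple R => v i)
  (fun x : 'rV[R]_5 => x 0 j)).
  exact: (@proj_continuous _ (fun=> 'rV[R]_5) i).
exact: coord_continuous.
Qed.

Lemma qdist_cvg v : qdist v v' @[v' --> v] --> 0.
Proof.
rewrite -(qdistxx v); do 2![apply: (@cvg_sumr _ _ (nbhs v)) => ?].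
by apply: cvg_norm; apply: cvgB; [apply: cvg_cst | apply: coordinate_continuous].
Qed.

(** Finitely many coordinates and minors are involved, each continuous, and a nonzero value keeps
    its sign nearby. *)
Lemma qdist_specializes v :
  exists2 e : R, 0 < e & forall v', qdist v v' < e -> specializes v v'.
Proof.
pose mx (v : quadruple R) : 'M[R]_(4, 5) := \matrix_(i, j) v i 0 j.
have coordM i j : (fun N : 'M[R]_(4, 5) => N i j) @ mx v --> v i 0 j.
  by have <- : mx v i j = v i 0 j by [rewrite mxE]; apply: coord_continuous.
pose P1 (k : 'I_4 * 'I_5) := [set N : 'M[R]_(4, 5) |
  v k.1 0 k.2 != 0 -> Num.sg (N k.1 k.2) = Num.sg (v k.1 0 k.2)].
have near1 k : \forall N \near mx v, P1 k N.
  have [v0|vp] := eqVneq (v k.1 0 k.2) 0.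
    by apply: (@nearW _ (nbhs (mx v))) => N; rewrite /P1 /= v0 eqxx.
  by apply: (@filterS _ (nbhs (mx v))) (cvg_sgr (coordM _ _) vp) => N sN _.
pose P2 (k : ('I_4 * 'I_4) * ('I_5 * 'I_5)) := [set N : 'M[R]_(4, 5) |
  minor k.2.1 k.2.2 (v k.1.1) (v k.1.2) != 0 ->
  Num.sg (N k.1.1 k.2.1 * N k.1.2 k.2.2 - N k.1.1 k.2.2 * N k.1.2 k.2.1) =
  Num.sg (minor k.2.1 k.2.2 (v k.1.1) (v k.1.2))].
have near2 k : \forall N \near mx v, P2 k N.
  have [v0|vm] := eqVneq (minor k.2.1 k.2.2 (v k.1.1) (v k.1.2)) 0.
    by apply: (@nearW _ (nbhs (mx v))) => N; rewrite /P2 /= v0 eqxx.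
  have cm : (N k.1.1 k.2.1 * N k.1.2 k.2.2 - N k.1.1 k.2.2 * N k.1.2 k.2.1)
      @[N --> mx v] --> minor k.2.1 k.2.2 (v k.1.1) (v k.1.2).
    by apply: cvgB; apply: cvgM; apply: coordM.
  by apply: (@filterS _ (nbhs (mx v))) (cvg_sgr cm vm) => N sN _.
have near12 : nbhs (mx v) [set N | (forall k, P1 k N) /\ (forall k, P2 k N)].
  by apply: filterI; apply: (@filter_forall _ _ _ (nbhs (mx v))).
have [e e0 be] := (nbhs_ballP _ _).1 near12.
exists e => // v' dv'; have [|N1 N2] := be (mx v').
  split=> // i j; rewrite /ball /= !mxE; apply: le_lt_trans dv'; exact: coord_le_qdist.
split=> [i p /(N1 (i, p))|i j p q /(N2 ((i, j), (p, q)))] /=; first by rewrite mxE.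
by rewrite !mxE.
Qed.

(* The cap 1 gives a meaning to the distance to the empty set. *)
Definition setdist A v :=
  inf [set r | r = 1 \/ exists2 v', A v' & r = qdist v v'].

Let dists_lb A v : has_lbound [set r | r = 1 \/ exists2 v', A v' & r = qdist v v'].
Proof. by exists 0 => r [->|[v' _ ->]] //; apply: qdist_ge0. Qed.

Lemma le_setdist A v e : e <= 1 -> (forall v', A v' -> e <= qdist v v') ->
  e <= setdist A v.
Proof.
move=> e1 eA; apply: lb_le_inf; first by exists 1; left.
by move=> r [->|[v' Av' ->]] //; apply: eA.
Qed.

Lemma setdist_le1 A v : setdist A v <= 1.
Proof. by apply: ge_inf => //; left. Qed.

Lemma setdist_le A v v' : A v' -> setdist A v <= qdist v v'.
Proof. by move=> Av'; apply: ge_inf => //; right; exists v'. Qed.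

Lemma setdist_ge0 A v : 0 <= setdist A v.
Proof. by apply: le_setdist => // v' _; apply: qdist_ge0. Qed.

Lemma setdist_mem A v : A v -> setdist A v = 0.
Proof.
by move=> Av; apply/le_anti; rewrite setdist_ge0 andbT -(qdistxx v) setdist_le.
Qed.

Lemma setdist_subset A B v : A `<=` B -> setdist B v <= setdist A v.
Proof.
by move=> AB; apply: le_setdist => [|v' /AB]; [apply: setdist_le1 | apply: setdist_le].
Qed.

Lemma setdist_lipschitz A v v' : setdist A v - setdist A v' <= qdist v v'.
Proof.
rewrite lerBlDl -lerBlDr; apply: le_setdist => [|v'' Av''].
  by rewrite lerBlDr (le_trans (setdist_le1 _ _)) // lerDl qdist_ge0.
by rewrite lerBlDr addrC (le_trans (setdist_le _ Av'')) // qdist_triangle.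
Qed.

Lemma setdist_continuous A : continuous (setdist A).
Proof.
move=> v; apply/(@cvgrPdist_lt _ _ _ (nbhs v)) => e e0.
apply: (@filterS _ (nbhs v)) (cvgr_lt _ (qdist_cvg v) _ e0) => v' /=; apply: le_lt_trans.
by rewrite ler_norml lerNl opprB {1}qdistC !setdist_lipschitz.
Qed.

Lemma setdist_act (w : W4) A B v : (forall v', A v' <-> B (act_config w v')) ->
  setdist B (act_config w v) = setdist A v.
Proof.
move=> AB; congr inf; apply/seteqP; split=> r [->|[v' Xv' ->]]; try by left.
  right; exists (act_config w^-1%g v').
    by apply/AB; rewrite -act_configM mulgV act_config1.
  by rewrite -[RHS](qdist_act w) -act_configM mulgV act_config1.
by right; exists (act_config w v'); [apply/AB | rewrite qdist_act].
Qed.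

End Distance.

(** * Weights of the sheets and projection to the sphere of [U4] *)

Section EquivariantMap.
Variable R : realType.
Implicit Types (v : quadruple R) (w g : W4) (k : nat).

Definition cube_act w (b : cube) : cube := cube_perm (w.2^-1)%g (b + w.1).

Lemma cube_act_inj w : injective (cube_act w).
Proof.
move=> b b' /(congr1 (cube_perm w.2)); rewrite -!cube_permM !mulVg !cube_perm1.
exact: addIr.
Qed.

Lemma card_cube : #|{: cube}| = 16%N.
Proof. by rewrite card_ffun !card_ord. Qed.

(** Dimensions 16 down to 3 become the indices 0 to 13. *)
Definition stratum k : set (quadruple R) :=
  [set v | S4_4_delta v /\ (16 - stratum_dim v)%N = k].

Definition sheet k w := [set v | stratum k v /\ label v w].
Definition other_sheets k w := [set v | stratum k v /\ ~ label v w].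

Definition weight k w v : R :=
  Num.max (setdist (other_sheets k w) v - setdist (sheet k w) v) 0.

Lemma weight_continuous k w : continuous (weight k w).
Proof.
move=> v; apply: (@continuous_max _ _ (fun v => setdist (other_sheets k w) v -
  setdist (sheet k w) v) (fun=> 0)); last exact: cst_continuous.
by apply: (@cvgB R R^o _ (nbhs v) _ (setdist _) (setdist _)); apply: setdist_continuous.
Qed.

(** For distinct labels each sheet lies among the other sheets of the other label, so the two strict
    comparisons of distances are incompatible. *)
Lemma weight_disjoint k w w' v : weight k w v != 0 -> weight k w' v != 0 -> w = w'.
Proof.
have pos x : weight k x v != 0 -> setdist (sheet k x) v < setdist (other_sheets k x) v.
  by rewrite /weight maxEle; case: ifPn => [|]; rewrite ?eqxx // -ltNge subr_gt0.
have sub x y : x <> y -> sheet k x `<=` other_sheets k y.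
  by move=> xy v' [sv' lx]; split=> // /(label_uniq lx).
move=> /pos lt1 /pos lt2; apply: contrapT => ww'.
have le1 := setdist_subset v (sub _ _ ww').
have le2 := setdist_subset v (sub _ _ (nesym ww')).
lra.
Qed.

(** The distance from [v] to its own sheet is 0, and rigidity keeps the other sheets of the same
    dimension out of a ball around [v]. *)
Lemma weight_gt0 v w : S4_4_delta v -> label v w -> 0 < weight (16 - stratum_dim v) w v.
Proof.
move=> vX lw; rewrite lt_max subr_gt0 ltxx orbF setdist_mem; last by split=> //; split.
have [e e0 eP] := qdist_specializes v.
(* The minimum with 1 accounts for the cap in [setdist]. *)
apply: (@lt_le_trans _ _ (Num.min e 1)); first by rewrite lt_min e0 ltr01.
apply: le_setdist => [|v' [[v'X dE] nlw]]; first by rewrite ge_min lexx orbT.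
rewrite ge_min leNgt; apply/orP; left; apply/negP => /eP vv'; apply: nlw.
apply: (label_rigid vX v'X vv' _ lw).
have [/andP[_ d16] /andP[_ d16']] := (stratum_dim_bounds vX, stratum_dim_bounds v'X).
by apply/eqP; rewrite -(eqn_add2l (16 - stratum_dim v')) subnK // dE subnK.
Qed.

(** The isometry given by [g] preserves each stratum and carries the sheet of [w] to that of
    [g * w]. *)
Lemma weight_act g k w v : weight k (g * w)%g (act_config g v) = weight k w v.
Proof.
have delta_act v' : S4_4_delta (act_config g v') <-> S4_4_delta v'.
  split=> [/(act_config_delta g^-1%g)|]; last exact: act_config_delta.
  by rewrite -act_configM mulVg act_config1.
have stratum_act v' : stratum k v' <-> stratum k (act_config g v').
  by split=> -[/delta_act v'X <-]; split=> //; rewrite ?stratum_dim_act //;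
    apply/delta_act.
have label_actE v' : stratum k v' -> label v' w <-> label (act_config g v') (g * w)%g.
  move=> [v'X _]; split=> [|/(label_act g^-1%g)]; first exact: label_act.
  by rewrite -act_configM mulgA mulVg act_config1 mul1g; apply; apply/delta_act.
have sheet_act v' : sheet k w v' <-> sheet k (g * w)%g (act_config g v').
  split=> -[s l]; first by split; [exact: (stratum_act v').1 | apply/(label_actE _ s)].
  by have s' := (stratum_act v').2 s; split=> //; apply/(label_actE _ s').
have other_act v' : other_sheets k w v' <-> other_sheets k (g * w)%g (act_config g v').
  split=> -[s l]; first by split; [exact: (stratum_act v').1 | move/(label_actE _ s)].
  by have s' := (stratum_act v').2 s; split=> // /(label_actE _ s').
by rewrite /weight (setdist_act _ other_act) (setdist_act _ sheet_act).
Qed.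

(** Orthogonal projection to [U4]; 16 is the number of vertices of the cube. *)
Definition center (h : cube -> R) (b : cube) := h b - (\sum_a h a) / 16.

Lemma sum_center h : \sum_b center h b = 0.
Proof.
rewrite sumrB sumr_const card_cube -[X in _ - X]mulr_natr.
by rewrite divfK ?subrr // pnatr_eq0.
Qed.

Definition sqnorm (h : cube -> R) := \sum_b h b ^+ 2.

Lemma sqnorm_ge0 h : 0 <= sqnorm h.
Proof. by apply: sumr_ge0 => b _; apply: sqr_ge0. Qed.

Lemma sqnorm_eq0 h : sqnorm h = 0 -> forall b, h b = 0.
Proof.
move=> /eqP; rewrite psumr_eq0 => [/allP h0 b|b _]; last exact: sqr_ge0.
by apply/eqP; rewrite -sqrf_eq0; apply: h0; rewrite mem_index_enum.
Qed.

Definition unit_vec (h : cube -> R) b := center h b / Num.sqrt (sqnorm (center h)).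

Lemma unit_vec_sphere h : sqnorm (center h) != 0 -> sphere_U4 (unit_vec h : V R).
Proof.
move=> h0; split; first by rewrite /U4 /= -mulr_suml sum_center mul0r.
rewrite /unit_vec; under eq_bigr do rewrite exprMn exprVn sqr_sqrtr ?sqnorm_ge0 //.
by rewrite -mulr_suml mulfV.
Qed.

Lemma unit_vec_act w h : unit_vec (act_V w h) = act_V w (unit_vec h).
Proof.
have cE b : center (act_V w h) b = center h (cube_act w b).
  by rewrite /center (act_V_sum id).
apply/funext => b; rewrite /act_V /unit_vec -/(cube_act w b) -cE; congr (_ / Num.sqrt _).
rewrite -[RHS](act_V_sum (fun x => x ^+ 2) w).
by apply: eq_bigr => a _; rewrite cE.
Qed.

Lemma unit_vec_cvg (X : topologicalType) (F : X -> V R) (x : X) :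
  (forall b, F y b @[y --> x] --> F x b) -> sqnorm (center (F x)) != 0 ->
  (unit_vec (F y) : V R) @[y --> x] --> (unit_vec (F x) : V R).
Proof.
move=> Fx nz; have cF b : center (F y) b @[y --> x] --> center (F x) b.
  by apply: cvgB => //; apply: cvgMr_tmp; apply: cvg_sumr.
apply: cvg_ptws => b; apply: (cvgM (cF b)); apply: cvgV.
  by rewrite sqrtr_eq0 -ltNge lt0r nz sqnorm_ge0.
have sqF : sqnorm (center (F y)) @[y --> x] --> sqnorm (center (F x)).
  by apply: cvg_sumr => a; apply: (cvgM (cF a) (cF a)).
exact: (cvg_comp _ _ sqF (@sqrt_continuous R _)).
Qed.

End EquivariantMap.

(** * Assembling the map from weights and generic vectors *)

Theorem theorem5p9 (R : realType) :
  exists f : quadruple R -> V R,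
    [/\ {within @S4_4_delta R, continuous f},
        (forall v, S4_4_delta v -> sphere_U4 (f v)) &
        (forall (w : W4) v, S4_4_delta v ->
           f (act_config w v) = act_V w (f v))].
Proof.
(* 15 is the dimension of [U4], the largest possible number of vectors independent modulo constants;
   all stratum indices lie below it. *)
have [|u uP] := @generic_vectors R cube W4 cube_act 15 cube_act_inj.
  by rewrite card_cube.
pose h v b : R := \sum_(k < 15) \sum_(w : W4) weight k w v * u k (cube_act w b).
have h_cvg v b : h v' b @[v' --> v] --> h v b.
  do 2![apply: (@cvg_sumr _ _ (nbhs v)) => ?].
  by apply: cvgMr_tmp; apply: weight_continuous.
have h_neq0 v : S4_4_delta v -> sqnorm (center (h v)) != 0.
  move=> vX; apply/eqP => /sqnorm_eq0 h0; have [w0 lw0] := label_ex vX.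
  (* The unique label of nonzero weight in stratum [k]; the default [1] arises when all these
     weights, hence the coefficient, are 0. *)
  pose wk k := if [pick w | weight k w v != 0] is Some w then w else 1%g.
  have wkP k w : weight k w v != 0 -> wk k = w.
    rewrite /wk; case: pickP => [w' n' n|/(_ w)->//]; exact: weight_disjoint n' n.
  pose k0 := (16 - stratum_dim v)%N.
  have w0_gt0 : 0 < weight k0 w0 v := weight_gt0 vX lw0.
  have k0lt : (k0 < 15)%N.
    have /andP[d3 _] := stratum_dim_bounds vX.
    by rewrite ltnS leq_subLR (leq_trans _ (leq_add d3 (leqnn 14))).
  (* A zero projection makes [h v] constant, equal to its mean; then [uP] kills every coefficient,
     against the positive one at [k0]. *)
  have : weight k0 (wk k0) v = 0.
    apply: (uP wk (fun k => weight k (wk k) v) ((\sum_a h v a) / 16)) => // b.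
    have /eqP := h0 b; rewrite subr_eq0 => /eqP <-; apply: eq_bigr => k _.
    rewrite (bigD1 (wk k)) //= big1 ?addr0 // => w /eqP wn.
    by have [->|/wkP/esym//] := eqVneq (weight k w v) 0; rewrite mul0r.
  by rewrite (wkP _ w0) ?gt_eqF // => e; rewrite e ltxx in w0_gt0.
have h_act g v : h (act_config g v) = act_V g (h v).
  apply/funext => b; apply: eq_bigr => k _.
  (* Left translation by [g] permutes the labels, as [weight_act] requires. *)
  rewrite (reindex_inj (mulgI g)); apply: eq_bigr => w _; rewrite weight_act.
  congr (_ * _); exact: (congr1 (@^~ b) (act_VM g w (u k : V R))).
exists (fun v => unit_vec (h v) : V R); split.
- apply: continuous_in_subspaceT => v /[!inE] vX.
  by apply: (unit_vec_cvg (F := h)) (h_neq0 _ vX).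
- by move=> v vX; apply: unit_vec_sphere; apply: h_neq0.
- by move=> g v vX; rewrite h_act unit_vec_act.
Qed.
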